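(* Let $(T_t)_{t\geq 0}$ be a $C_0$-semigroup on a separable Banach space $X\neq\{0\}$. If $(T_t)_{t\ge 0}$ has the specification property for semigroups (SgSP) with respect to an increasing sequence $(K_n)_n$ of invariant compact sets (that is, the sets $K_n$ in the definition of the SgSP can be taken to be compact), then $(T_t)_{t\ge 0}$ is distributionally chaotic.
   Context: A $C_0$-semigroup on a Banach space $X$ is a family $(T_t)_{t\ge 0}$ of bounded linear operators on $X$ with $T_0=\mathrm{Id}$, $T_tT_s=T_{t+s}$ for all $t,s\ge 0$, and $\lim_{t\to s}T_tx=T_sx$ for all $x\in X$, $s\ge 0$. SgSP: A $C_0$-semigroup $(T_t)_{t\ge 0}$ on a separable Banach space $X$ has the SgSP (with respect to $(K_n)_n$) if there exist an increasing sequence $(K_n)_{n\in\mathbb{N}}$ of subsets of $X$ with $0\in K_1$ and $\overline{\bigcup_{n} K_n}=X$, and a $t_0>0$, such that for each $n\in\mathbb{N}$ the set $K_n$ is $T_{t_0}$-invariant (i.e. $T_{t_0}(K_n)\subset K_n$), and for every $\delta>0$ there is $M_{\delta,n}>t_0$ such that for any integer $s\ge 2$, any set $\{y_1,\dots,y_s\}\subset K_n$ and any real numbers $0=a_1\le b_1<a_2\le b_2<\dots<a_s\le b_s$ satisfying $a_{r+1}-b_r\ge M_{\delta,n}$ for $r=1,\dots,s-1$, there is a point $x\in K_n$ such that - $\|T_t(x)-T_t(y_r)\|<\delta$ for each $t\in[a_r,b_r]$, $r=1,\dots,s$; - $T_{t'}(x)=x$, where $t'$ is the (unique) element of $[M_{\delta,n}+b_s,\,M_{\delta,n}+b_s+t_0)\cap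 \mathbb{N}\cdot t_0$, with $\mathbb{N}\cdot t_0=\{kt_0 : k\in\mathbb{N}\}$. Distributional chaos: $(T_t)_{t\ge 0}$ is distributionally chaotic if there are an uncountable set $S\subset X$ and $\delta>0$ such that for each $\varepsilon>0$ and each pair $x,y\in S$ of distinct points, $$\overline{\operatorname{Dens}}\{s\ge 0:\|T_sx-T_sy\|\ge\delta\}=1\quad\text{and}\quad \overline{\operatorname{Dens}}\{s\ge 0:\|T_sx-T_sy\|<\varepsilon\}=1,$$ where, for a Lebesgue measurable $B\subset[0,\infty)$, $\overline{\operatorname{Dens}}(B)=\limsup_{t\to\infty}\mu(B\cap[0,t])/t$ with $\mu$ the Lebesgue measure. *)

(* Defs.v *)
From mathcomp Require Export all_boot all_order all_algebra.
From mathcomp Require Export all_classical all_reals all_analysis.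

Set Implicit Arguments.
Unset Strict Implicit.
Unset Printing Implicit Defensive.

Import Order.TTheory GRing.Theory Num.Theory.
Import numFieldNormedType.Exports.

Local Open Scope classical_set_scope.
Local Open Scope ring_scope.

Definition separable_space (X : topologicalType) : Prop :=
  exists A : set X, countable A /\ dense A.

(* Scalars are the reals: the notions below involve the scalars only through
   the linearity of the T t, so a complex Banach space is covered by
   restricting its scalars. *)
Section Semigroup.
Context {R : realType} {X : completeNormedModType R}.

(* Families are indexed by all of R, but only times t >= 0 are ever used. *)
Implicit Types T : R -> {linear X -> X}.

Record C0_semigroup T : Prop := {
  C0_bounded : forall t : R, 0 <= t ->
    exists M : R, forall x : X, `|T t x| <= M * `|x| ;
  C0_0 : forall x : X, T 0 x = x ;
  C0_add : forall t s : R, 0 <= t -> 0 <= s -> forall x : X,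
    T t (T s x) = T (t + s) x ;
  C0_continuous : forall x : X,
    {within [set t : R | 0 <= t], continuous (fun t : R => T t x)}
}.

(* The sets K_1, K_2, ... are K 0, K 1, ...; likewise the s points and the s
   time intervals are indexed by 0, ..., s - 1 (values of y, a and b at indices
   r >= s are ignored). The points need not be pairwise distinct. The element
   t' = k t0 of the half-open interval of length t0 exists and is unique, so
   quantifying over all such k singles it out. *)
Definition SgSP T (K : nat -> set X) : Prop :=
  {homo K : m n / (m <= n)%N >-> m `<=` n} /\
  K 0%N 0 /\
  closure (\bigcup_n K n) = [set: X] /\
  exists2 t0 : R, 0 < t0 & forall n : nat,
    T t0 @` K n `<=` K n /\
    forall delta : R, 0 < delta -> exists2 M : R, t0 < M &
      forall (s : nat) (y : nat -> X) (a b : nat -> R),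
        (2 <= s)%N ->
        (forall r, (r < s)%N -> K n (y r)) ->
        a 0%N = 0 ->
        (forall r, (r < s)%N -> a r <= b r) ->
        (forall r, (r.+1 < s)%N -> b r < a r.+1) ->
        (forall r, (r.+1 < s)%N -> M <= a r.+1 - b r) ->
        exists2 x : X, K n x &
          (forall r, (r < s)%N -> forall t : R, t \in `[a r, b r] ->
             `|T t x - T t (y r)| < delta) /\
          (forall k : nat,
             k%:R * t0 \in `[M + b s.-1, M + b s.-1 + t0[ ->
             T (k%:R * t0) x = x).

Definition upper_density (B : set R) : \bar R :=
  limf_esup (fun t : R => (lebesgue_measure (B `&` `[0%R, t]) / t%:E)%E) +oo.

Definition distributionally_chaotic T : Prop :=
  exists S : set X, ~ countable S /\
  exists2 delta : R, 0 < delta &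
    forall eps : R, 0 < eps ->
    forall x y : X, S x -> S y -> x <> y ->
      upper_density [set s : R | 0 <= s /\ delta <= `|T s x - T s y|] = 1%E /\
      upper_density [set s : R | 0 <= s /\ `|T s x - T s y| < eps] = 1%E.

End Semigroup.

(* Main.v *)
Require Import Defs.
From mathcomp Require Import lra zify.

(* Specification gives a nonzero periodic point [p] in some [K n], and the orbit
   of [p] stays at distance at least [m > 0] from that of the fixed point [0].
   Given a sequence of targets in [K n], two-block specification is applied
   repeatedly: each new point follows the previous one on the past and the next
   target on a new time block, with error [2^-j]. These points converge, and the
   limit follows the [j]-th target on the whole [j]-th block. The gaps required
   by the specification are fixed before the block lengths, so the [j]-th block
   can be made to fill [0, b j] up to the fraction 1 / (j + 1). Taking targets in
   {0, p} prescribed by binary codes, any two of which agree infinitely often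
   and differ infinitely often, yields the uncountable scrambled set. *)

Set Implicit Arguments.
Unset Strict Implicit.
Unset Printing Implicit Defensive.

Import Order.TTheory GRing.Theory Num.Theory.
Import numFieldNormedType.Exports.

Local Open Scope classical_set_scope.
Local Open Scope ring_scope.

(** * Upper density and long blocks *)

(* Lebesgue measure is defined as the restriction of an outer measure, so
   monotonicity needs no measurability. *)
Lemma le_lebesgue_measure (R : realType) (A B : set R) :
  A `<=` B -> (lebesgue_measure A <= lebesgue_measure B)%E.
Proof.
rewrite /lebesgue_measure /lebesgue_stieltjes_measure /measure_extension.
move=> AB; exact: (le_mu_ext (wlength idfun) AB).
Qed.

(** At time [b] the block alone makes the quotient at least [1 - eta], and [b] can be taken beyond
    any [C]. *)
Lemma upper_density_eq1 (R : realType) (B : set R) :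
  (forall eta C : R, 0 < eta -> exists a b : R,
    [/\ 0 <= a, a <= b, C < b, a <= eta * b & `[a, b] `<=` B]) ->
  upper_density B = 1%E.
Proof.
move=> blocks; apply/eqP; rewrite eq_le; apply/andP; split.
  apply: (@le_trans _ _ (ereal_sup [set
      (lebesgue_measure (B `&` `[0%R, t]) / t%:E)%E | t in [set t : R | 0 < t]])).
    apply: ereal_inf_lbound; exists [set t : R | 0 < t] => //.
    by exists 0; split => // ; exact: real0.
  apply: ge_ereal_sup => _ [t /= t0 <-].
  rewrite inver gt_eqF// lee_pdivrMr// mul1e.
  apply: le_trans (le_lebesgue_measure (@subIsetr _ B `[0%R, t])) _.
  by rewrite lebesgue_measure_itv/= lte_fin t0 oppr0 adde0.
apply: le_ereal_inf_tmp => _ [V [C [_ CV]] <-].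
apply/lee_addgt0Pr => eta eta0.
have [a [b [a0 ab Cb aeta abB]]] := blocks eta (Num.max C 0) eta0.
have [C'b b0] : C < b /\ 0 < b by move: Cb; rewrite gt_max => /andP[].
apply: (@le_trans _ _ ((1 - eta)%:E + eta%:E)%E).
  by rewrite -EFinD subrK.
apply: leeD => //.
apply: le_trans (ereal_sup_ubound _); last by exists b => //; exact: CV.
rewrite inver gt_eqF// lee_pdivlMr//.
have abB' : `[a, b]%classic `<=` B `&` `[0%R, b].
  move=> t tab; split; first exact: abB.
  by move: tab; rewrite /= !in_itv/= => /andP[at_ ->]; rewrite (le_trans a0 at_).
apply: le_trans (le_lebesgue_measure abB').
rewrite lebesgue_measure_itv/= lte_fin.
(* If the block is a single point, [a <= eta * b] makes the required lower bound nonpositive. *)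
case: ltP => [_|ba]; rewrite -EFinM -?EFinB lee_fin; last first.
  have -> : b = a by apply/eqP; rewrite eq_le ab ba.
  by nra.
by lra.
Qed.

(** Cantor's diagonal argument: the value of [D] at its own index [g (f D)] is contradictory. *)
Lemma not_countable_range_bool_seq (Y : Type) (f : (nat -> bool) -> Y) :
  injective f -> ~ countable (range f).
Proof.
move=> f_inj /countable_injP[g g_inj].
have gf_inj alpha beta : g (f alpha) = g (f beta) -> alpha = beta.
  by move=> e; apply: f_inj; apply: g_inj e; rewrite inE; [exists alpha|exists beta].
pose D n := `[< exists2 alpha, g (f alpha) = n & alpha n = false >].
have [DD|DD] := boolP (D (g (f D))).
  move: (DD) => /asboolP[alpha /gf_inj -> Df].
  by rewrite Df in DD.
move: (DD) => /asboolP; apply.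
by exists D => //; apply: negbTE.
Qed.

Lemma multiple_in_itv (R : realType) (a d : R) :
  0 < d -> 0 <= a -> exists k : nat, a <= k%:R * d < a + d.
Proof.
move=> d0 a0; have a1 : exists k : nat, a <= k%:R * d.
  exists (Num.truncn (a / d)).+1; rewrite -ler_pdivrMr// ltW//.
  by have /andP[] := truncn_itv (divr_ge0 a0 (ltW d0)).
case: (ex_minnP a1) => -[|k] ak k_min.
  by exists 0%N; rewrite ak mul0r; lra.
exists k.+1; rewrite ak/=; case: ltP => // hi.
by have := k_min k; rewrite ltnn; apply; rewrite -natr1 in hi; lra.
Qed.

(** * Specification and a nonzero periodic orbit *)

Section Semigroup.
Context {R : realType} {X : completeNormedModType R}.
Context (T : R -> {linear X -> X}).

Lemma SgSP_two_blocks (K : nat -> set X) (n : nat) (e : R) :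
  SgSP T K -> 0 < e -> exists2 M : R, 1 <= M &
    forall (x z : X) (b a c : R), K n x -> K n z ->
      0 <= b -> b + M <= a -> a <= c ->
      exists2 w : X, K n w &
        (forall t, 0 <= t <= b -> `|T t w - T t x| <= e) /\
        (forall t, a <= t <= c -> `|T t w - T t z| <= e).
Proof.
move=> [_ [_ [_ [t0 t0_gt0 /(_ n)[_ spec]]]]] /spec[M t0M {}spec].
(* The added 1 yields [1 <= M], which later makes the block ends grow at least linearly. *)
exists (M + 1); first by lra.
move=> x z b a c Kx Kz b0 ba ac.
have [||||||w Kw [track _]] := spec 2%N (fun r => if r is 0%N then x else z)
  (fun r => if r is 0%N then 0 else a) (fun r => if r is 0%N then b else c) => //.
- by case.
- by case.
- by case=> // _; lra.
- by case=> // _; lra.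
exists w => //; split=> t t_itv.
  by apply/ltW/(track 0%N).
by apply/ltW/(track 1%N).
Qed.

Lemma SgSP_nonzero_periodic (K : nat -> set X) :
  [set: X] <> [set 0] -> C0_semigroup T -> SgSP T K ->
  exists n (p : X) (P : R), [/\ K n p, p != 0, 0 < P & T P p = p].
Proof.
move=> X0 T_sg [_ [K00 [Kdense [t0 t0_gt0 spec]]]].
have [n [y Ky y0]] : exists n, exists2 y, K n y & y != 0.
  apply: contrapT => none; apply: X0; apply/seteqP; split => // x _ /=.
  have /(@closure_subset X _ [set 0]) : \bigcup_n K n `<=` [set 0 : X].
    move=> y [n _ Ky] /=; apply/eqP; apply: contrapT => /negP y0.
    by apply: none; exists n, y.
  have /closure_id <- : closed [set 0 : X].
    exact: (accessible_closed_set1 (hausdorff_accessible (@norm_hausdorff _ X))).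
  by rewrite Kdense; apply.
have y_gt0 : 0 < `|y| by rewrite normr_gt0.
(* An error below [|y|] at time 0 keeps the tracking point away from 0. *)
have [_ /(_ (`|y|) y_gt0)[M t0M {}spec]] := spec n.
(* Both blocks are single times, 0 and [M]; the second one only brings their number to two. *)
have [||||||x Kx [track per]] := spec 2%N (fun=> y)
  (fun r => if r is 0%N then 0 else M) (fun r => if r is 0%N then 0 else M) => //.
- by case=> // _; lra.
- by case=> // _; lra.
have MM0 : 0 <= M + M by lra.
have [k /[dup] k_itv /andP[k_lo _]] := multiple_in_itv t0_gt0 MM0.
exists n, x, (k%:R * t0); split => //.
- have := track 0%N isT 0; rewrite in_itv/= lexx => /(_ isT).
  rewrite !(C0_0 T_sg); apply: contraTneq => ->.
  by rewrite sub0r normrN ltxx.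
- by lra.
- by apply: per; rewrite in_itv.
Qed.

Lemma C0_iter_period (p : X) (P : R) (m : nat) :
  C0_semigroup T -> 0 <= P -> T P p = p -> T (m%:R * P) p = p.
Proof.
move=> T_sg P0 Tp; elim: m => [|m IHm]; first by rewrite mul0r (C0_0 T_sg).
rewrite -natr1 mulrDl mul1r -(C0_add T_sg) ?mulr_ge0//.
by rewrite Tp.
Qed.

(* A semigroup orbit that hits 0 stays there, so a nonzero periodic orbit
   avoids 0, and its closure is the compact image of one period. *)
Lemma C0_periodic_bounded_below (p : X) (P : R) :
  C0_semigroup T -> 0 < P -> T P p = p -> p != 0 ->
  exists2 m : R, 0 < m & forall t, 0 <= t -> m <= `|T t p|.
Proof.
move=> T_sg P0 Tp p0.
have Tmod (t : R) : 0 <= t -> exists2 r, r \in `[0, P] & T t p = T r p.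
  move=> t0.
  have /andP[] := truncn_itv (divr_ge0 t0 (ltW P0)).
  set m := Num.truncn _; rewrite ler_pdivlMr// ltr_pdivrMr// => lo hi.
  have rP : 0 <= t - m%:R * P <= P by rewrite -natr1 in hi; apply/andP; split; lra.
  exists (t - m%:R * P); first by rewrite in_itv.
  case/andP: rP => r0 _; have mP0 : 0 <= m%:R * P by rewrite mulr_ge0// ltW.
  rewrite -[in LHS](subrK (m%:R * P) t) -(C0_add T_sg r0 mP0).
  by rewrite (C0_iter_period _ T_sg (ltW P0) Tp).
have cont : {within `[0, P], continuous (fun t : R => `|T t p|)}.
  apply: (@continuous_subspaceW _ _ _ [set t : R | 0 <= t]).
    by move=> t /=; rewrite in_itv/= => /andP[].
  by move=> t; apply: cvg_norm; exact: (C0_continuous T_sg).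
have [c c_itv c_min] := EVT_min (ltW P0) cont.
exists `|T c p|.
  rewrite normr_gt0; apply: contraNneq p0 => Tc0.
  move: c_itv; rewrite in_itv/= => /andP[c0 cP].
  rewrite -Tp -(subrK c P) -(C0_add T_sg)//; last by lra.
  by rewrite Tc0 linear0.
by move=> t /Tmod[r r_itv ->]; exact: c_min.
Qed.

(** * Shadowing infinitely many targets *)

Lemma C0_orbit_limit (x : nat -> X) (c : nat -> R) :
  C0_semigroup T -> nondecreasing_seq c -> 0 <= c 0%N ->
  (forall j t, 0 <= t <= c j ->
    `|T t (x j.+1) - T t (x j)| <= 2^-1 ^+ j) ->
  exists y : X, forall j t, 0 <= t <= c j ->
    `|T t y - T t (x j)| <= 2 * 2^-1 ^+ j.
Proof.
move=> T_sg c_mono c0 step.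
(* The subtracted term makes this the exact partial geometric sum, so the induction closes. *)
have tele j m t : 0 <= t <= c j ->
    `|T t (x (m + j)%N) - T t (x j)| <= 2 * 2^-1 ^+ j - 2 * 2^-1 ^+ (m + j).
  move=> /andP[t0 tc]; elim: m => [|m IHm]; first by rewrite !subrr normr0.
  have /step : 0 <= t <= c (m + j)%N.
    by rewrite t0 (le_trans tc)//; apply: c_mono; exact: leq_addl.
  rewrite addSn exprS; set e := 2^-1 ^+ (m + j) in IHm * => sm.
  have := ler_distD (T t (x (m + j)%N)) (T t (x (m + j).+1)) (T t (x j)).
  by lra.
(* Since [T 0] is the identity, time 0 turns orbit estimates into norm estimates. *)
have dist0 j m : `|x (m + j)%N - x j| <= 2 * 2^-1 ^+ j.
  have cj0 : 0 <= c j := le_trans c0 (c_mono _ _ (leq0n j)).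
  have := @tele j m 0; rewrite !(C0_0 T_sg) lexx cj0 => /(_ isT).
  have : 0 <= (2^-1 : R) ^+ (m + j) by apply: exprn_ge0.
  by lra.
have small (e : R) : 0 < e -> exists j : nat, 2 * 2^-1 ^+ j < e.
  move=> e0; have [j _ /(_ j (leqnn j))/=] :=
    near_infty_natSinv_expn_lt (PosNum (divr_gt0 e0 (ltr0n R 2))).
  by rewrite div1r -exprVn => ?; exists j; lra.
have /cauchy_cvg : cauchy (x @ \oo).
  apply: cauchy_exP => e /small[j je]; exists (x j).
  exists j => // i /= ji; rewrite -ball_normE/= distrC.
  by apply: le_lt_trans je; rewrite -(subnK ji); exact: dist0.
move=> /cvg_ex[y xy]; exists y => j t /[dup] t_itv /andP[t0 _].
have [L TL] := C0_bounded T_sg t0.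
apply/ler_addgt0Pr => e e0.
pose L' := Num.max L 1.
have L'0 : 0 < L' by rewrite lt_max ltr01 orbT.
have L'L : L <= L' by rewrite le_max lexx.
have /cvgrPdist_le/(_ _ (divr_gt0 e0 L'0)) := xy.
case=> N _ /(_ (N + j)%N (leq_addr _ _))/= near_y.
rewrite ler_pdivlMr// in near_y.
have Tnear : `|T t y - T t (x (N + j)%N)| <= e.
  rewrite -linearB; apply: le_trans (TL _) _; apply: le_trans near_y.
  by rewrite mulrC ler_wpM2l.
have := tele j N t t_itv.
have := ler_distD (T t (x (N + j)%N)) (T t y) (T t (x j)).
have : 0 <= (2^-1 : R) ^+ (N + j) by apply: exprn_ge0.
by lra.
Qed.

(** The blocks are chosen before the targets, so that the same blocks serve all codes at once. *)
Lemma SgSP_shadowing (K : nat -> set X) (n : nat) :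
  C0_semigroup T -> SgSP T K ->
  exists a b : nat -> R,
    (forall j, [/\ 0 <= a j, a j <= b j, j%:R <= b j & j.+1%:R * a j <= b j]) /\
    forall z : nat -> X, (forall j, K n (z j)) ->
      exists x : X, forall j t, a j <= t <= b j ->
        `|T t x - T t (z j)| <= 2 * 2^-1 ^+ j.
Proof.
move=> T_sg K_spec.
have Kn0 : K n 0 by case: K_spec => K_mono [K00 _]; exact: K_mono K00.
have half_gt0 j : 0 < (2^-1 : R) ^+ j by rewrite exprn_gt0.
have /choice[M M_spec] j : exists M : R, 1 <= M /\
    forall (x z : X) (b a c : R), K n x -> K n z ->
      0 <= b -> b + M <= a -> a <= c ->
      exists2 w : X, K n w &
        (forall t, 0 <= t <= b -> `|T t w - T t x| <= 2^-1 ^+ j) /\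
        (forall t, a <= t <= c -> `|T t w - T t z| <= 2^-1 ^+ j).
  by have [M M1 HM] := SgSP_two_blocks n K_spec (half_gt0 j); exists M.
(* Stage [j] ends at [c j.+1 = j.+1 * a j], the length that gives the required ratio. *)
pose c := fix c j : R := if j is i.+1 then i.+1%:R * (c i + M i) else 0.
pose a j := c j + M j.
have M1 j : 1 <= M j by case: (M_spec j).
have c0 j : 0 <= c j.
  by elim: j => //= j IHj; rewrite mulr_ge0// addr_ge0// (le_trans ler01).
have a0 j : 0 <= a j by rewrite addr_ge0// (le_trans ler01).
have ac j : a j <= c j.+1 by apply: ler_peMl; [exact: a0|rewrite ler1n].
have cj j : j%:R <= c j.
  elim: j => // j IHj; apply: le_trans (ac j); rewrite -natr1 /a.
  exact: lerD.
exists a, (fun j => c j.+1); split.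
  by move=> j; split => //; apply: le_trans (cj _); rewrite ler_nat.
move=> z Kz.
(* Guarding by [K n jx.2] lets [F] be total, with 0 as default value. *)
have /choice[F F_spec] (jx : nat * X) : exists w, K n jx.2 -> K n w /\
    (forall t, 0 <= t <= c jx.1 -> `|T t w - T t jx.2| <= 2^-1 ^+ jx.1) /\
    (forall t, a jx.1 <= t <= c jx.1.+1 ->
      `|T t w - T t (z jx.1)| <= 2^-1 ^+ jx.1).
  case: jx => j x /=; have [Kx|nKx] := pselect (K n x); last by exists 0.
  have [_ step] := M_spec j.
  have [w Kw ww] := step x (z j) (c j) (a j) (c j.+1) Kx (Kz j) (c0 j) (lexx _) (ac j).
  by exists w.
pose x := fix x j : X := if j is i.+1 then F (i, x i) else 0.
have Kx j : K n (x j).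
  by elim: j => //= j IHj; have [] := F_spec (j, x j) IHj.
have c_mono : nondecreasing_seq c.
  apply/nondecreasing_seqP => j; apply: le_trans (ac j).
  by rewrite lerDl (le_trans ler01).
have [||y xy] := @C0_orbit_limit x c T_sg c_mono => //.
  by move=> j t tc; have [_ [+ _]] := F_spec (j, x j) (Kx j); apply.
exists y => j t /andP[ta tc].
have [_ [_ /(_ t)]] := F_spec (j, x j) (Kx j).
rewrite /= -/(x j.+1) ta tc => /(_ isT).
(* The block error [2^-j] and the later errors, [2 * 2^-(j+1)] in total, add up to [2 * 2^-j]. *)
have := xy j.+1 t; rewrite (le_trans (a0 j) ta) tc exprS => /(_ isT).
have := ler_distD (T t (x j.+1)) (T t y) (T t (z j)).
by rewrite /=; lra.
Qed.

End Semigroup.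

(** * Binary codes and block densities *)

(* Odd positions always carry [false], so that any two codes agree infinitely
   often; even positions repeat each value of [alpha] infinitely often. *)
Definition code (alpha : nat -> bool) (j : nat) : bool :=
  ~~ odd j && alpha (logn 2 j).-1.

Lemma code_odd (alpha : nat -> bool) (j : nat) : odd j -> code alpha j = false.
Proof. by rewrite /code => ->. Qed.

(** The 2-adic valuation of such a position is [i.+1]; varying [N] makes the position as large as
    desired. *)
Lemma code_frequently (alpha : nat -> bool) (i N : nat) :
  code alpha (2 ^ i.+1 * N.*2.+1) = alpha i.
Proof.
rewrite /code oddM oddX/= lognM ?expn_gt0// pfactorK//.
by rewrite [logn 2 _]logn_coprime ?addn0// prime_coprime// dvdn2/= odd_double.
Qed.

Lemma blocks_upper_density (R : realType) (a b : nat -> R) (B : set R) :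
  (forall j, [/\ 0 <= a j, a j <= b j, j%:R <= b j & j.+1%:R * a j <= b j]) ->
  (forall N, exists2 j, (N <= j)%N & `[a j, b j] `<=` B) ->
  upper_density B = 1%E.
Proof.
move=> ab freq; apply: upper_density_eq1 => eta C eta0.
(* From [N1] on, [b j] exceeds [C]; from [N2] on, [a j / b j] is at most [eta]. *)
pose N1 := (Num.truncn (Num.max C 0)).+1.
pose N2 := (Num.truncn eta^-1).+1.
have [j Nj jB] := freq (maxn N1 N2).
have [a0 aleb jb ja] := ab j; exists (a j), (b j); split => //.
  apply: lt_le_trans jb; apply: (@lt_le_trans _ _ N1%:R).
    have C0 : 0 <= Num.max C 0 by rewrite le_max lexx orbT.
    have /andP[_] := truncn_itv C0.
    by apply: le_lt_trans; rewrite le_max lexx.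
  by rewrite ler_nat (leq_trans _ Nj)// leq_maxl.
have jeta : eta^-1 <= j.+1%:R.
  have etaV0 : 0 <= eta^-1 by rewrite invr_ge0 ltW.
  have /andP[_ /ltW/le_trans] := truncn_itv etaV0.
  by apply; rewrite ler_nat ltnW// ltnS (leq_trans _ Nj)// leq_maxr.
rewrite mulrC -ler_pdivrMr// mulrC; apply: le_trans ja.
exact: ler_wpM2r.
Qed.

(** * The scrambled set *)

Theorem proposition8 (R : realType) (X : completeNormedModType R)
  (T : R -> {linear X -> X}) (K : nat -> set X)
  (X_separable : separable_space X)
  (X_nontrivial : [set: X] <> [set 0])
  (T_semigroup : C0_semigroup T)
  (K_compact : forall n : nat, compact (K n))
  (T_SgSP : SgSP T K) :
  distributionally_chaotic T.
Proof.
have [n [p [P [Kp p0 P0 Tp]]]] :=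
  SgSP_nonzero_periodic X_nontrivial T_semigroup T_SgSP.
have [m m0 pm] := C0_periodic_bounded_below T_semigroup P0 Tp p0.
have [a [b [ab shadow]]] := SgSP_shadowing n T_semigroup T_SgSP.
have Kn0 : K n 0 by case: T_SgSP => K_mono [K00 _]; exact: K_mono K00.
pose z alpha j : X := if code alpha j then p else 0.
have /choice[x x_spec] alpha : exists x : X, forall j t, a j <= t <= b j ->
    `|T t x - T t (z alpha j)| <= 2 * 2^-1 ^+ j.
  by apply: shadow => j; rewrite /z; case: ifP.
have err (e : R) : 0 < e -> exists N, forall j, (N <= j)%N ->
    2 * 2^-1 ^+ j < e.
  move=> e0.
  have [N _ HN] :=
    near_infty_natSinv_expn_lt (PosNum (divr_gt0 e0 (ltr0n R 2))).
  by exists N => j /HN/=; rewrite div1r -exprVn; lra.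
have t_ge0 j t : a j <= t -> 0 <= t by have [+ _ _ _] := ab j; exact: le_trans.
have far alpha beta : alpha <> beta -> forall N, exists2 j, (N <= j)%N &
    `[a j, b j] `<=`
      [set s | 0 <= s /\ m / 2 <= `|T s (x alpha) - T s (x beta)|].
  move=> neq N.
  have [i i_neq] : exists i, alpha i <> beta i by apply/existsNP => /funext.
  (* Two tracking errors below [m / 4] leave [m / 2] of the separation [m] between the orbits of [p]
     and 0. *)
  have [N' HN'] := err (m / 4) (divr_gt0 m0 (ltr0n R 4)).
  pose j := (2 ^ i.+1 * (maxn N N').*2.+1)%N.
  have jN : (maxn N N' <= j)%N.
    apply: (@leq_trans (1 * (maxn N N').*2.+1)%N); first by lia.
    by rewrite leq_mul2r expn_gt0 orbT.
  exists j; first by apply: leq_trans jN; exact: leq_maxl.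
  have {}HN' := HN' j (leq_trans (leq_maxr _ _) jN).
  move=> t /=; rewrite in_itv/= => tj.
  have t0 : 0 <= t by case/andP: tj => /t_ge0.
  split => //.
  have zz : m <= `|T t (z alpha j) - T t (z beta j)|.
    rewrite /z !code_frequently.
    by case: (alpha i) (beta i) i_neq => -[]// _;
      rewrite linear0 ?subr0 ?sub0r ?normrN pm.
  have := x_spec alpha j t tj; have := x_spec beta j t tj.
  have := ler_distD (T t (x alpha)) (T t (z alpha j)) (T t (z beta j)).
  have := ler_distD (T t (x beta)) (T t (x alpha)) (T t (z beta j)).
  by rewrite (distrC (T t (z alpha j)) (T t (x alpha))); lra.
have close alpha beta (e : R) : 0 < e -> forall N, exists2 j, (N <= j)%N &
    `[a j, b j] `<=` [set s | 0 <= s /\ `|T s (x alpha) - T s (x beta)| < e].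
  move=> e0 N; have [N' HN'] := err (e / 2) (divr_gt0 e0 (ltr0n R 2)).
  (* At an odd position both targets are 0, so each orbit has norm below [e / 2]. *)
  exists (maxn N N').*2.+1; first by lia.
  have {}HN' := HN' (maxn N N').*2.+1 ltac:(lia).
  move=> t /=; rewrite in_itv/= => tj.
  have t0 : 0 <= t by case/andP: tj => /t_ge0.
  split => //.
  have := x_spec alpha _ t tj; have := x_spec beta _ t tj.
  rewrite /z !code_odd/= ?odd_double// linear0 !subr0 => hb ha.
  by have := ler_normB (T t (x alpha)) (T t (x beta)); lra.
(* Distinct codes give orbits at distance at least [m / 2] at some time, hence distinct points. *)
have x_inj : injective x.
  move=> alpha beta xx; apply: contrapT => /far/(_ 0%N)[j _ /(_ (a j))].
  have [_ aleb _ _] := ab j; rewrite /= in_itv/= lexx aleb => /(_ isT)[_].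
  by rewrite xx subrr normr0; lra.
exists (range x); split; first exact: not_countable_range_bool_seq.
exists (m / 2); first by lra.
move=> e e0 _ _ [alpha _ <-] [beta _ <-] xneq; split.
  apply: (blocks_upper_density ab); apply: far.
  by move=> ab_eq; apply: xneq; rewrite ab_eq.
exact/(blocks_upper_density ab)/close.
Qed.
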